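(* Let $M=S^3-K$ where $K$ is the trefoil knot, so that $\pi_1(M)=B_3=\langle c_1,c_2,h\mid c_1^2=c_2^3=h,\ c_ih=hc_i\rangle$. If $e_i,e_j\in B_3$ are distinct elements conjugate to $c_2$, then every element of $B_3$ conjugate to $e_ie_j^2h^{-1}$ is a generalised $3$-torsion element.
   Context: An element $g$ of a group $G$ is a generalised $n$-torsion element if there exist $k_1,\dots,k_n\in G$ with $k_1gk_1^{-1}k_2gk_2^{-1}\cdots k_ngk_n^{-1}=\mathrm{Id}$. $B_3$ is the braid group on 3 strands. *)

(* Defs.v *)
From HB Require Import structures.
From mathcomp Require Import all_boot boolp.

Set Implicit Arguments.
Unset Strict Implicit.
Unset Printing Implicit Defensive.

Local Open Scope quotient_scope.
Local Open Scope group_scope.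

Section Presentation.
Variable X : choiceType.

(* The letter (x, false) stands for the generator x, (x, true) for x^-1. *)
Definition word := seq (X * bool).

Definition letter (x : X) : X * bool := (x, false).

Definition inv_word (w : word) : word := rev [seq (l.1, ~~ l.2) | l <- w].

Variable R : word -> word -> Prop.

(* The congruence generated by x x^-1 = x^-1 x = 1 and the relations u = v,
   R u v; the quotient of the words by it is the group < X | R >. *)
Inductive word_eq : word -> word -> Prop :=
| word_eq_refl u : word_eq u u
| word_eq_sym u v : word_eq u v -> word_eq v u
| word_eq_trans u v w : word_eq u v -> word_eq v w -> word_eq u w
| word_eq_cat u u' v v' : word_eq u u' -> word_eq v v' ->
    word_eq (u ++ v) (u' ++ v')
| word_eq_cancel x b : word_eq [:: (x, b); (x, ~~ b)] [::]
| word_eq_rel u v : R u v -> word_eq u v.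

Definition word_eqb (u v : word) : bool := `[< word_eq u v >].

Lemma word_eqb_refl : reflexive word_eqb.
Proof. by move=> u; apply/asboolP/word_eq_refl. Qed.

Lemma word_eqb_sym : symmetric word_eqb.
Proof. by move=> u v; apply/asboolP/asboolP => /word_eq_sym. Qed.

Lemma word_eqb_trans : transitive word_eqb.
Proof.
by move=> v u w /asboolP uv /asboolP vw; apply/asboolP/(word_eq_trans uv vw).
Qed.

Definition word_equiv : equiv_rel word :=
  EquivRel word_eqb word_eqb_refl word_eqb_sym word_eqb_trans.

Definition presented_group := {eq_quot word_equiv}.

HB.instance Definition _ := Choice.on presented_group.
HB.instance Definition _ := EqQuotient.on presented_group.

Definition class (w : word) : presented_group := \pi w.

Definition pgen (x : X) : presented_group := class [:: letter x].

Lemma class_eq u v : class u = class v <-> word_eq u v.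
Proof.
split => [/eqmodP/asboolP //|uv].
by apply/eqmodP/asboolP.
Qed.

Lemma word_eq_repr u : word_eq (repr (class u)) u.
Proof. by apply/class_eq; rewrite /class reprK. Qed.

Lemma word_eq_invr w : word_eq (w ++ inv_word w) [::].
Proof.
elim: w => [|[x b] w IHw]; first exact: word_eq_refl.
have -> : ((x, b) :: w) ++ inv_word ((x, b) :: w)
        = [:: (x, b)] ++ (w ++ inv_word w) ++ [:: (x, ~~ b)].
  by rewrite /inv_word /= rev_cons -cats1 -catA.
apply: word_eq_trans (word_eq_cancel x b).
apply: (@word_eq_cat [:: (x, b)] [:: (x, b)]); first exact: word_eq_refl.
rewrite -[X in word_eq _ X]cat0s.
by apply: word_eq_cat; [exact: IHw | exact: word_eq_refl].
Qed.

Lemma inv_wordK : involutive inv_word.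
Proof.
move=> w; rewrite /inv_word map_rev revK -map_comp -[RHS]map_id.
by apply: eq_map => -[x b] /=; rewrite negbK.
Qed.

Lemma word_eq_invl w : word_eq (inv_word w ++ w) [::].
Proof. by rewrite -{2}(inv_wordK w); apply: word_eq_invr. Qed.

Lemma word_eq_inv u v : word_eq u v -> word_eq (inv_word u) (inv_word v).
Proof.
move=> uv; apply: (@word_eq_trans _ (inv_word u ++ (v ++ inv_word v))).
  rewrite -[X in word_eq X _]cats0; apply: word_eq_cat.
    exact: word_eq_refl.
  exact/word_eq_sym/word_eq_invr.
rewrite catA -[X in word_eq _ X]cat0s; apply: word_eq_cat.
  apply: word_eq_trans (word_eq_invl u).
  apply: word_eq_cat; [exact: word_eq_refl | exact: word_eq_sym].
exact: word_eq_refl.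
Qed.

Definition pmul (a b : presented_group) : presented_group :=
  class (repr a ++ repr b).
Definition pinv (a : presented_group) : presented_group :=
  class (inv_word (repr a)).

Lemma pmul_class u v : pmul (class u) (class v) = class (u ++ v).
Proof. by apply/class_eq; apply: word_eq_cat; apply: word_eq_repr. Qed.

Lemma pinv_class u : pinv (class u) = class (inv_word u).
Proof. exact/class_eq/word_eq_inv/word_eq_repr. Qed.

Lemma classP (P : presented_group -> Prop) :
  (forall w, P (class w)) -> forall a, P a.
Proof. by move=> Pc a; rewrite -[a]reprK. Qed.

Lemma pmulA : associative pmul.
Proof.
elim/classP => u; elim/classP => v; elim/classP => w.
by rewrite !pmul_class catA.
Qed.

Lemma pmul1g : left_id (class [::]) pmul.
Proof. by elim/classP => u; rewrite pmul_class. Qed.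

Lemma pmulg1 : right_id (class [::]) pmul.
Proof. by elim/classP => u; rewrite pmul_class cats0. Qed.

Lemma pmulVg : left_inverse (class [::]) pinv pmul.
Proof.
by elim/classP => u; rewrite pinv_class pmul_class; apply/class_eq/word_eq_invl.
Qed.

Lemma pmulgV : right_inverse (class [::]) pinv pmul.
Proof.
by elim/classP => u; rewrite pinv_class pmul_class; apply/class_eq/word_eq_invr.
Qed.

HB.instance Definition _ :=
  isGroup.Build presented_group pmulA pmul1g pmulg1 pmulVg pmulgV.

Lemma class_cat u v : class (u ++ v) = class u * class v.
Proof. by rewrite -pmul_class. Qed.

Lemma class_inv u : class (inv_word u) = (class u)^-1.
Proof. by rewrite -pinv_class. Qed.

Section Lift.
Variables (G : groupType) (f : X -> G).

Definition eval (w : word) : G :=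
  \prod_(l <- w) (if l.2 then (f l.1)^-1 else f l.1).

Lemma eval_cat u v : eval (u ++ v) = eval u * eval v.
Proof. exact: big_cat. Qed.

Hypothesis fR : forall u v, R u v -> eval u = eval v.

Lemma eval_word_eq u v : word_eq u v -> eval u = eval v.
Proof.
elim=> {u v} [//|//|u v w _ -> _ -> //|u u' v v' _ e1 _ e2|x b|//].
  by rewrite !eval_cat e1 e2.
by rewrite /eval !big_cons big_nil /= mulg1; case: b; rewrite ?mulVg ?mulgV.
Qed.

Definition plift (a : presented_group) : G := eval (repr a).

Lemma plift_class w : plift (class w) = eval w.
Proof. exact/eval_word_eq/word_eq_repr. Qed.

Lemma pliftM : {morph plift : a b / a * b}.
Proof.
elim/classP => u; elim/classP => v.
by rewrite -class_cat !plift_class eval_cat.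
Qed.

Lemma plift_pgen x : plift (pgen x) = f x.
Proof. by rewrite plift_class /eval big_seq1. Qed.

End Lift.

Lemma presented_group_UP (G : groupType) (f : X -> G) :
  (forall u v, R u v -> eval f u = eval f v) ->
  exists phi : {multiplicative presented_group -> G},
    forall x, phi (pgen x) = f x.
Proof.
move=> fR; pose m := isMultiplicative.Build _ _ _ (pliftM fR).
pose phi : {multiplicative presented_group -> G} :=
  HB.pack (plift f) m.
by exists phi => x; apply: plift_pgen.
Qed.

Lemma gmulf_1V (G H : groupType) (f : {multiplicative G -> H}) :
  f 1 = 1 /\ {morph f : x / x^-1}.
Proof.
have f1 : f 1 = 1 by apply: (@mulgI _ (f 1)); rewrite -gmulfM !mulg1.
by split=> // x; apply: (@mulgI _ (f x)); rewrite -gmulfM !mulgV.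
Qed.

Lemma class_eval w : class w = eval pgen w.
Proof.
elim: w => [|[x b] w IHw]; first by rewrite /eval big_nil.
rewrite /eval big_cons -/(eval pgen w) -IHw -cat1s class_cat; congr (_ * _).
by case: b => //=; rewrite -class_inv.
Qed.

Lemma presented_group_rel u v : R u v -> eval pgen u = eval pgen v.
Proof. by move=> uv; rewrite -!class_eval; apply/class_eq/word_eq_rel. Qed.

Lemma presented_group_cancel (G : groupType)
    (f : {multiplicative presented_group -> G})
    (g : {multiplicative G -> presented_group}) :
  (forall x, g (f (pgen x)) = pgen x) -> cancel f g.
Proof.
move=> fg; elim/classP => w; rewrite class_eval /eval.
have [f1 fV] := gmulf_1V f; have [g1 gV] := gmulf_1V g.
elim: w => [|[x b] w IHw]; first by rewrite big_nil f1 g1.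
by rewrite big_cons !gmulfM IHw; case: b; rewrite /= ?fV ?gV fg.
Qed.

End Presentation.

(* Artin's presentation: s_i exchanges the strands i and i + 1. *)
Inductive braid_rel (n : nat) : word 'I_n.-1 -> word 'I_n.-1 -> Prop :=
| braid_far (i j : 'I_n.-1) : i.+1 < j ->
    braid_rel [:: letter i; letter j] [:: letter j; letter i]
| braid_near (i j : 'I_n.-1) : j = i.+1 :> nat ->
    braid_rel [:: letter i; letter j; letter i]
              [:: letter j; letter i; letter j].

Definition braid_group (n : nat) := presented_group (@braid_rel n).

(* < c1, c2, h | c1^2 = c2^3 = h, c1 h = h c1, c2 h = h c2 >, the fundamental
   group of the complement of the trefoil knot in S^3. *)
Inductive trefoil_gen := gen_c1 | gen_c2 | gen_h.

Definition trefoil_gen_ord (x : trefoil_gen) : 'I_3 :=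
  match x with gen_c1 => inord 0 | gen_c2 => inord 1 | gen_h => inord 2 end.
Definition ord_trefoil_gen (i : 'I_3) : trefoil_gen :=
  match val i with 0 => gen_c1 | 1 => gen_c2 | _ => gen_h end.

Lemma trefoil_gen_ordK : cancel trefoil_gen_ord ord_trefoil_gen.
Proof. by case; rewrite /ord_trefoil_gen /= inordK. Qed.

HB.instance Definition _ := Choice.copy trefoil_gen (can_type trefoil_gen_ordK).

Inductive trefoil_rel : word trefoil_gen -> word trefoil_gen -> Prop :=
| trefoil_c1 : trefoil_rel [:: letter gen_c1; letter gen_c1] [:: letter gen_h]
| trefoil_c2 : trefoil_rel
    [:: letter gen_c2; letter gen_c2; letter gen_c2] [:: letter gen_h]
| trefoil_c1h : trefoil_rel
    [:: letter gen_c1; letter gen_h] [:: letter gen_h; letter gen_c1]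
| trefoil_c2h : trefoil_rel
    [:: letter gen_c2; letter gen_h] [:: letter gen_h; letter gen_c2].

Definition trefoil_group := presented_group trefoil_rel.

Definition c1 : trefoil_group := pgen trefoil_rel gen_c1.
Definition c2 : trefoil_group := pgen trefoil_rel gen_c2.
Definition h : trefoil_group := pgen trefoil_rel gen_h.

Definition conjugate (G : groupType) (x y : G) : Prop := exists k : G, y = x ^ k.

(* No condition g <> 1 is imposed. *)
Definition generalised_torsion (G : groupType) (n : nat) (g : G) : Prop :=
  exists k : 'I_n -> G, \prod_(i < n) (k i * g * (k i)^-1) = 1.

(* The isomorphism sends c1 to s_1 s_2 s_1 and c2 to s_1 s_2. *)
Lemma trefoil_braid_iso :
  exists phi : {multiplicative trefoil_group -> braid_group 3}, bijective phi.
Proof.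
pose s1 : braid_group 3 := pgen (@braid_rel 3) ord0.
pose s2 : braid_group 3 := pgen (@braid_rel 3) ord_max.
have sss : s1 * s2 * s1 = s2 * s1 * s2.
  have /= := presented_group_rel (@braid_near 3 ord0 ord_max erefl).
  by rewrite /eval !big_cons big_nil /= !mulg1 !mulgA.
pose f x : braid_group 3 := match x with
  gen_c1 => s1 * s2 * s1 | gen_c2 => s1 * s2 | gen_h => (s1 * s2) ^+ 3 end.
have hE : (s1 * s2 * s1) * (s1 * s2 * s1) = (s1 * s2) ^+ 3.
  by rewrite {2}sss !expgS !mulgA mulg1.
have [phi phiE] : exists phi : {multiplicative trefoil_group -> braid_group 3},
    forall x, phi (pgen trefoil_rel x) = f x.
  apply: presented_group_UP => u v []; rewrite /eval !big_cons big_nil /= ?mulg1.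
  - exact: hE.
  - by rewrite !expgS mulg1.
  - by rewrite -hE !mulgA.
  - by rewrite -expgS -expgSr.
pose t1 : trefoil_group := c2^-1 * c1.
pose t2 : trefoil_group := c1^-1 * c2 ^+ 2.
have c12 : c1 * c1 = h.
  have := presented_group_rel trefoil_c1.
  by rewrite /eval !big_cons big_nil /= !mulg1.
have c23 : c2 ^+ 3 = h.
  have := presented_group_rel trefoil_c2.
  by rewrite /eval !big_cons big_nil /= !mulg1.
have t12 : t1 * t2 = c2 by rewrite /t1 /t2 -mulgA mulVKg expgS expg1 mulKg.
have t121 : t1 * t2 * t1 = c1 by rewrite t12 /t1 mulVKg.
have t212 : t2 * t1 * t2 = c1.
  by rewrite -mulgA t12 /t2 -mulgA -expgSr c23 -c12 mulKg.
pose g (i : 'I_2) : trefoil_group := if i == ord0 then t1 else t2.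
have [psi psiE] : exists psi : {multiplicative braid_group 3 -> trefoil_group},
    forall i, psi (pgen (@braid_rel 3) i) = g i.
  apply: presented_group_UP => u v [] i j.
    by case: i j => [[|[|i]] Hi] [[|[|j]] Hj].
  move=> ij; have i0 : i = ord0.
    by apply/val_inj; case: i j ij => [[|[|i]] Hi] [[|[|j]] Hj].
  have j1 : j = ord_max by apply/val_inj; rewrite /= ij i0.
  rewrite /eval !big_cons big_nil i0 j1 /= !mulg1.
  rewrite -[LHS]/(t1 * (t2 * t1)) -[RHS]/(t2 * (t1 * t2)).
  by rewrite (mulgA t1) (mulgA t2) t121 t212.
have ps1 : psi s1 = t1 by rewrite psiE.
have ps2 : psi s2 = t2 by rewrite psiE.
have pc1 : phi c1 = s1 * s2 * s1 by rewrite phiE.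
have pc2 : phi c2 = s1 * s2 by rewrite phiE.
have [phi1 phiV] := gmulf_1V phi.
have pt1 : phi t1 = s1 by rewrite /t1 gmulfM phiV pc1 pc2 mulKg.
have pt2 : phi t2 = s2.
  by apply: (@mulgI _ s1); rewrite -{1}pt1 -gmulfM t12; exact: pc2.
exists phi; exists psi; apply: presented_group_cancel.
- case; rewrite phiE /=.
  + by rewrite !gmulfM ps1 ps2.
  + by rewrite gmulfM ps1 ps2.
  + by rewrite !expgS !gmulfM (gmulf_1V psi).1 ps1 ps2 t12 mulg1; exact: c23.
- move=> i; rewrite psiE /g.
  case: eqP => [->|ni0]; first exact: pt1.
  rewrite pt2; congr (pgen _ _); apply/val_inj => /=.
  by case: i ni0 => [[|[|i]] Hi] // []; apply/val_inj.
Qed.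

(* Main.v *)
Require Import Defs.
From HB Require Import structures.
From mathcomp Require Import all_boot boolp.

(* Conjugates of c2 are cube roots of the central element h, so
   e_i e_j^2 h^-1 = e_i e_j^-1 with e_i^3 = e_j^3.  Whenever a^n = b^n, the
   product of the conjugates b^i (a b^-1) b^-i for i < n telescopes to
   a^n b^-n = 1. *)

Local Open Scope group_scope.

Lemma prod_conj_divg (G : groupType) (a b : G) (n : nat) :
  \prod_(i < n) (b ^+ i * (a * b^-1) * (b ^+ i)^-1) = a ^+ n * (b ^+ n)^-1.
Proof.
elim: n => [|n IHn]; first by rewrite big_ord0 !expg0 mulgV.
(* The leading [b ^+ n] of the last factor cancels the trailing [(b ^+ n)^-1] of the induction
   hypothesis. *)
by rewrite big_ord_recr /= IHn expgSr expgSr invgM !mulgA mulgVK.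
Qed.

Lemma generalised_torsion_divg (G : groupType) (a b : G) (n : nat) :
  a ^+ n = b ^+ n -> generalised_torsion n (a * b^-1).
Proof.
by move=> ab; exists (fun i => b ^+ i); rewrite prod_conj_divg ab mulgV.
Qed.

Lemma generalised_torsion_conjugate (G : groupType) (n : nat) (g x : G) :
  conjugate g x -> generalised_torsion n g -> generalised_torsion n x.
Proof.
(* Since [g ^ k] is [k^-1 * g * k], the extra [k] undoes the conjugation and each factor of the
   product stays the same. *)
move=> [k ->] [l lg]; exists (fun i => l i * k); rewrite -[RHS]lg.
apply: eq_bigr => i _.
by rewrite conjgE invgM !mulgA !mulgK.
Qed.

(** The centraliser of [z] is closed under products and inverses, and every element is the value of
    a word in the generators. *)
Lemma pgen_commute (X : choiceType) (R : word X -> word X -> Prop)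
    (z : presented_group R) :
  (forall x, commute z (pgen R x)) -> forall a, commute z a.
Proof.
move=> zX; elim/classP => w; rewrite class_eval; apply: commute_prod => -[x [|]] _ //=.
exact: commuteV.
Qed.

Lemma c2_cube : c2 ^+ 3 = h.
Proof.
have := presented_group_rel trefoil_c2.
by rewrite /eval !big_cons big_nil /= !mulg1.
Qed.

Lemma h_central (a : trefoil_group) : commute h a.
Proof.
apply: pgen_commute => -[|//|//].
- have := presented_group_rel trefoil_c1h.
  by rewrite /eval !big_cons big_nil /= !mulg1 => /esym.
- have := presented_group_rel trefoil_c2h.
  by rewrite /eval !big_cons big_nil /= !mulg1 => /esym.
Qed.

Lemma conjugate_c2_cube {G : groupType}
    {phi : {multiplicative trefoil_group -> G}} {e : G} :
  bijective phi -> conjugate (phi c2) e -> e ^+ 3 = phi h.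
Proof.
move=> [psi _ psiK] [k ->].
have c23 : phi c2 ^+ 3 = phi h.
  by rewrite -c2_cube !expgS !gmulfM (gmulf_1V phi).1.
(* Surjectivity enters here: writing [k] as [phi (psi k)] carries the centrality of [h] over to
   [phi h]. *)
by rewrite -conjXg c23 -[k]psiK conjgE -gmulfM h_central gmulfM mulKg.
Qed.

Theorem corollary5p8
    (phi : {multiplicative trefoil_group -> braid_group 3})
    (phi_iso : bijective phi)
    (ei ej : braid_group 3)
    (ei_conj : conjugate (phi c2) ei)
    (ej_conj : conjugate (phi c2) ej)
    (ei_neq_ej : ei <> ej)
    (x : braid_group 3)
    (x_conj : conjugate (ei * ej ^+ 2 * (phi h)^-1) x) :
  generalised_torsion 3 x.
Proof.
have ei3 := conjugate_c2_cube phi_iso ei_conj.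
have ej3 := conjugate_c2_cube phi_iso ej_conj.
apply: generalised_torsion_conjugate x_conj _.
have -> : ei * ej ^+ 2 * (phi h)^-1 = ei * ej^-1.
  (* Splitting the cube as [ej * ej ^+ 2] makes its inverse begin with [(ej ^+ 2)^-1], next to the
     [ej ^+ 2] that it cancels. *)
  by rewrite -ej3 (expgS ej 2) invgM mulgA mulgK.
by apply: generalised_torsion_divg; rewrite ei3.
Qed.
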